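(* Let $\mathfrak G$ be a family of finite groups each of which has a distributive lattice of normal subgroups. Then every quasiregular coherent configuration of type $\mathfrak G$ (i.e. such that the group formed by the basis relations of each homogeneous component is a member of $\mathfrak G$) is schurian and separable.
   Context: A coherent configuration is a pair $\mathcal X=(\Omega,S)$ where $\Omega$ is a finite set and $S$ is a partition of $\Omega\times\Omega$ (basis relations) such that the diagonal $1_\Omega$ is a union of basis relations, $s^*=\{(\beta,\alpha):(\alpha,\beta)\in s\}\in S$ for all $s\in S$, and for all $r,s,t\in S$ the number $c^t_{rs}=|\alpha r\cap \beta s^*|$ does not depend on the choice of $(\alpha,\beta)\in t$, where $\alpha r=\{\beta:(\alpha,\beta)\in r\}$. A fiber is a set $\Delta$ with $1_\Delta\in S$; the homogeneous component on a fiber $\Delta$ is $(\Delta,\{s\in S:s\subseteq\Delta\times\Delta\})$. A relation $s$ is thin if $|\alpha s|\le1$ and $|\alpha s^*|\le 1$ for all $\alpha$. A regular scheme is a coherent configuration with one fiber all of whose basis relations are thin; its basis relations form a group under composition of relations. A coherent configuration is quasiregular if all its homogeneous components are regular schemes. It is schurian if $S$ is the set of orbits on $\Omega\times\Omega$ of some permutation group on $\Omega$. An algebraic isomorphism from $(\Omega,S)$ to a coherent configuration $(\Omega',S')$ is a bijection $\varphi:S\to S'$ with $c^t_{rs}=c^{\varphi(t)}_{\varphi(r)\varphi(s)}$ for all $r,s,t\in S$; the configuration is separable if for every such $\varphi$ there is a bijection $f:\Omega\to\Omega'$ with $\{(\alpha^f,\beta^f):(\alpha,\beta)\in s\}=\varphi(s)$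 for all $s\in S$. *)

(* Defs.v *)
From mathcomp Require Import all_boot all_fingroup.

Set Implicit Arguments.
Unset Strict Implicit.
Unset Printing Implicit Defensive.

Definition diag (T : finType) (D : {set T}) : {set T * T} :=
  [set (x, x) | x in D].

Definition conv (T : finType) (s : {set T * T}) : {set T * T} :=
  [set p | (p.2, p.1) \in s].

Definition nbr (T : finType) (a : T) (s : {set T * T}) : {set T} :=
  [set b | (a, b) \in s].

Definition rcomp (T : finType) (r s : {set T * T}) : {set T * T} :=
  [set p | [exists b, ((p.1, b) \in r) && ((b, p.2) \in s)]].

Definition relim (T T' : finType) (f : T -> T') (s : {set T * T}) :
    {set T' * T'} :=
  [set (f p.1, f p.2) | p in s].

Definition nint (T : finType) (r s : {set T * T}) (a b : T) : nat :=
  #|nbr a r :&: nbr b (conv s)|.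

Definition coherent (T : finType) (S : {set {set T * T}}) : Prop :=
  [/\ partition S [set: T * T],
      exists2 D : {set {set T * T}}, D \subset S & diag [set: T] = cover D,
      forall s, s \in S -> conv s \in S
    & forall r s t, r \in S -> s \in S -> t \in S ->
      forall a b a' b', (a, b) \in t -> (a', b') \in t ->
      nint r s a b = nint r s a' b'].

Record coherent_config (T : finType) := CoherentConfig {
  basis : {set {set T * T}};
  basisP : coherent basis
}.

(* The intersection number c^t_{rs}, read off at an arbitrary pair of t;    *)
(* basis relations are nonempty, so the default value 0 is never used.      *)
Definition intersection_number (T : finType) (r s t : {set T * T}) : nat :=
  if [pick p in t] is Some p then nint r s p.1 p.2 else 0.

Definition fibers (T : finType) (X : coherent_config T) : {set {set T}} :=
  [set D | diag D \in basis X].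

Definition restrict (T : finType) (D : {set T}) (s : {set T * T}) :
    {set {x : T | x \in D} * {x : T | x \in D}} :=
  [set p | (val p.1, val p.2) \in s].

Definition component_basis (T : finType) (S : {set {set T * T}})
    (D : {set T}) : {set {set {x : T | x \in D} * {x : T | x \in D}}} :=
  [set restrict D s | s in [set s in S | s \subset setX D D]].

Lemma mem_diag (T : finType) (D : {set T}) x y :
  ((x, y) \in diag D) = (x == y) && (x \in D).
Proof.
apply/imsetP/andP => [[z zD [-> ->]]|[/eqP<- xD]]; first by rewrite eqxx.
by exists x.
Qed.

Lemma fiber_subset (T : finType) (X : coherent_config T) D s a b :
  D \in fibers X -> s \in basis X -> (a, b) \in s -> a \in D -> b \in D ->
  s \subset setX D D.
Proof.
rewrite inE; case: (basisP X) => _ _ convS cohS dD sS abs aD bD.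
have left r x y x' y' : r \in basis X -> (x, y) \in r -> x \in D ->
    (x', y') \in r -> x' \in D.
  move=> rS xyr xD xyr'; have := cohS _ _ _ dD rS rS _ _ _ _ xyr xyr'.
  have -> : nint (diag D) r x y = 1%N.
    rewrite /nint (_ : _ :&: _ = [set x]) ?cards1 //.
    apply/setP=> z; rewrite !inE mem_diag xD andbT /= eq_sym.
    by case: eqP => [->|].
  move=> /esym card1; have /card_gt0P[z] : 0 < nint (diag D) r x' y'.
    by rewrite card1.
  by rewrite !inE mem_diag => /andP[/andP[]].
apply/subsetP=> -[x y] xys; rewrite in_setX; apply/andP; split.
  exact: left sS abs aD xys.
by apply: (left (conv s) b a y x); rewrite ?convS ?inE.
Qed.

Lemma restrict_in (T : finType) (D : {set T}) (s : {set T * T}) p :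
  (p \in restrict D s) = ((val p.1, val p.2) \in s).
Proof. by rewrite inE. Qed.

Lemma component_coherent (T : finType) (X : coherent_config T) (D : {set T}) :
  D \in fibers X -> coherent (component_basis (basis X) D).
Proof.
move=> fD; have dD : diag D \in basis X by rewrite inE in fD.
case: (basisP X) => partS _ convS cohS.
have [/eqP covS trivS S0] := and3P partS.
have inD (u : {x : T | x \in D}) : val u \in D by exact: valP.
split.
- apply/and3P; split.
  + apply/eqP/setP=> -[u v]; rewrite inE; apply/bigcupP.
    have : (val u, val v) \in cover (basis X) by rewrite covS inE.
    case/bigcupP=> s sS uvs; exists (restrict D s); last by rewrite inE.
    apply/imsetP; exists s => //; rewrite inE sS /=.
    exact: fiber_subset fD sS uvs (inD u) (inD v).
  + apply/trivIsetP=> r' s' /imsetP[r /setIdP[rS _] ->{r'}].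
    move=> /imsetP[s /setIdP[sS _] ->{s'}] neq.
    have neqrs : r != s by apply: contraNneq neq => ->.
    rewrite disjoints_subset; apply/subsetP=> p; rewrite !inE => pr.
    have := trivIsetP trivS _ _ rS sS neqrs.
    by rewrite disjoint_subset => /subsetP/(_ _ pr); rewrite inE.
  + apply/imsetP=> -[s /setIdP[sS /subsetP sD] /setP s0].
    have [s_0|[[a b] abs]] := set_0Vmem s; first by rewrite s_0 (negPf S0) in sS.
    have /setXP[aD bD] := sD _ abs.
    by have := s0 (exist _ a aD, exist _ b bD); rewrite !inE /= abs.
- exists [set restrict D (diag D)].
    rewrite sub1set; apply/imsetP; exists (diag D) => //; rewrite inE dD /=.
    apply/subsetP=> -[x y]; rewrite mem_diag in_setX.
    by case/andP=> /eqP<- ->.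
  rewrite /cover big_set1; apply/setP=> -[u v].
  by rewrite mem_diag !inE mem_diag inD !andbT.
- move=> _ /imsetP[s /setIdP[sS /subsetP sD] ->].
  apply/imsetP; exists (conv s); last by apply/setP=> p; rewrite !inE.
  rewrite inE convS //=; apply/subsetP=> -[x y]; rewrite inE => /sD.
  by rewrite !in_setX andbC.
- move=> r' s' t' /imsetP[r /setIdP[rS /subsetP rD] ->{r'}].
  move=> /imsetP[s /setIdP[sS _] ->{s'}] /imsetP[t /setIdP[tS _] ->{t'}].
  have E u v : nint (restrict D r) (restrict D s) u v = nint r s (val u) (val v).
    rewrite /nint -(card_imset _ val_inj); congr #|pred_of_set _|.
    apply/setP=> z; apply/imsetP/idP => [[w + ->]|]; first by rewrite !inE.
    rewrite !inE /= => /andP[zr zs]; have /setXP[_ zD] := rD _ zr.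
    by exists (exist _ z zD); rewrite ?inE /= ?zr.
  move=> a b a' b'; rewrite !restrict_in !E; exact: cohS.
Qed.

Definition component (T : finType) (X : coherent_config T) (D : {set T})
    (fD : D \in fibers X) : coherent_config {x : T | x \in D} :=
  CoherentConfig (component_coherent fD).

Definition thin (T : finType) (s : {set T * T}) : Prop :=
  forall a, #|nbr a s| <= 1 /\ #|nbr a (conv s)| <= 1.

Definition regular_scheme (T : finType) (X : coherent_config T) : Prop :=
  #|fibers X| = 1 /\ forall s, s \in basis X -> thin s.

Definition quasiregular (T : finType) (X : coherent_config T) : Prop :=
  forall (D : {set T}) (fD : D \in fibers X), regular_scheme (component fD).

(* G is isomorphic to the group of basis relations of the regular scheme X, *)
(* whose product is the composition of relations.                           *)
Definition isog_basis (T : finType) (X : coherent_config T)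
    (gT : finGroupType) (G : {group gT}) : Prop :=
  exists f : gT -> {set T * T},
    [/\ {in G &, injective f},
        f @: G = basis X
      & {in G &, {morph f : x y / (x * y)%g >-> rcomp x y}}].

(* Membership in a family of finite groups is understood up to isomorphism. *)
Definition of_type (T : finType) (X : coherent_config T)
    (GG : forall gT : finGroupType, {group gT} -> Prop) : Prop :=
  forall (D : {set T}) (fD : D \in fibers X),
    exists (gT : finGroupType) (G : {group gT}),
      GG gT G /\ isog_basis (component fD) G.

Definition distributive_normal_lattice (gT : finGroupType) (G : {group gT}) :
    Prop :=
  forall A B C : {group gT}, (A <| G)%g -> (B <| G)%g -> (C <| G)%g ->
    (A :&: (B <*> C) = (A :&: B) <*> (A :&: C))%g.

Definition pair_orbit (T : finType) (G : {group {perm T}}) (p : T * T) :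
    {set T * T} :=
  [set (g p.1, g p.2) | g : {perm T} in G].

Definition schurian (T : finType) (X : coherent_config T) : Prop :=
  exists G : {group {perm T}},
    basis X = [set pair_orbit G p | p in [set: T * T]].

(* Only the values of phi on the basis relations of X matter.               *)
Definition algebraic_isomorphism (T T' : finType)
    (X : coherent_config T) (X' : coherent_config T')
    (phi : {set T * T} -> {set T' * T'}) : Prop :=
  [/\ {in basis X &, injective phi},
      phi @: basis X = basis X'
    & forall r s t, r \in basis X -> s \in basis X -> t \in basis X ->
      intersection_number r s t =
      intersection_number (phi r) (phi s) (phi t)].

Definition separable (T : finType) (X : coherent_config T) : Prop :=
  forall (T' : finType) (X' : coherent_config T')
    (phi : {set T * T} -> {set T' * T'}),
    algebraic_isomorphism X X' phi ->
    exists2 f : T -> T', bijective f &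
      forall s, s \in basis X -> relim f s = phi s.

(* Main.v *)
Require Import Defs.
From mathcomp Require Import all_boot all_fingroup.

Set Implicit Arguments.
Unset Strict Implicit.
Unset Printing Implicit Defensive.

(* Let X' be algebraically isomorphic to X.  A map from a set of points of X' to
   X that respects the colors (basis relations) extends to one more point e: the
   image y must satisfy, for each a already mapped to g a, that (g a, y) lies in
   a prescribed relation.  Inside the regular fiber that contains y, each such
   condition cuts out a coset of a normal subgroup, and any two of these cosets
   meet because the intersection numbers of X and X' agree.  In a group whose
   lattice of normal subgroups is distributive the Chinese remainder theorem
   holds, so all the cosets meet.  Extending the empty map gives separability;
   extending (a, b) |-> (c, d) when (a, b) and (c, d) have the same color, with
   X' = X, gives schurity. *)

(** * Distributive lattices of normal subgroups and the Chinese remainder theorem *)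

Section Distributive.
Local Open Scope group_scope.

(** In any lattice, distributivity of meet over join implies its dual; between normal subgroups the
    join is the product. *)
Lemma distributive_mulI (gT : finGroupType) (G A B C : {group gT}) :
  distributive_normal_lattice G -> A <| G -> B <| G -> C <| G ->
  (B * A) :&: (C * A) = (B :&: C) * A.
Proof.
move=> dG nA nB nC.
have joinE (K L : {group gT}) : K <| G -> L <| G -> K <*> L = K * L.
  move=> /andP[sK _] /andP[_ nL]; apply: norm_joinEl.
  exact: subset_trans sK nL.
have nI : B :&: C <| G by rewrite normalI.
have nBA : B <*> A <| G by rewrite normalY.
rewrite -!joinE // [C <*> A]joingC.
rewrite (dG (B <*> A)%G A C) //= [_ :&: A]setIC.
have /setIidPl -> : A \subset B <*> A by rewrite joing_subr.
rewrite setIC joingC (dG C B A) // -joingA.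
have /joing_idPr -> : C :&: A \subset A by rewrite subsetIr.
by rewrite setIC.
Qed.

(** [B] is the intersection of [G] with all [A i] for [i] in [I], and the dual law is applied once
    per index. *)
Lemma distributive_mul_bigcap (gT : finGroupType) (G : {group gT})
    (J : eqType) (I : seq J) (A : J -> {group gT}) (N : {group gT}) :
  distributive_normal_lattice G -> (forall i, A i <| G) -> N <| G ->
  exists B : {group gT}, [/\ B <| G, forall i, i \in I -> B \subset A i
    & forall g, g \in G -> (forall i, i \in I -> g \in A i * N) -> g \in B * N].
Proof.
move=> dG nA nN; elim: I => [|i I [B [nB sB memB]]].
  exists G; split=> // g gG _; rewrite -[g]mulg1; exact: mem_mulg.
exists (B :&: A i)%G; split=> [|j|g gG gA]; first by rewrite normalI.
  rewrite inE => /predU1P[->|/sB]; first exact: subsetIr.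
  by apply: subset_trans; apply: subsetIl.
rewrite -(distributive_mulI dG) // inE gA ?mem_head // andbT.
by apply: memB => // j jI; apply: gA; rewrite inE jI orbT.
Qed.

Lemma distributive_chinese (gT : finGroupType) (G : {group gT})
    (J : eqType) (I : seq J) (A : J -> {group gT}) (P : J -> gT -> Prop) :
  distributive_normal_lattice G -> (forall i, A i <| G) ->
  (forall i x y, x \in G -> y \in G -> P i x ->
     P i y <-> x^-1 * y \in A i) ->
  (forall i j, i \in I -> j \in I -> exists x, [/\ x \in G, P i x & P j x]) ->
  exists2 x, x \in G & forall i, i \in I -> P i x.
Proof.
move=> dG nA cosetP; elim: I => [|i I IH] meetP; first by exists 1.
have [j k jI kI|x xG Px] := IH.
  by apply: meetP; rewrite inE ?jI ?kI orbT.
have [B [/andP[sBG _] sB memB]] :=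
  distributive_mul_bigcap I dG nA (nA i).
(* Pairing [i] with itself shows that the coset [P i] is nonempty. *)
have [y [yG Py _]] := meetP i i (mem_head _ _) (mem_head _ _).
have /mulsgP[b a bB aA def] : x^-1 * y \in B * A i.
  apply: memB => [|j jI]; first by rewrite groupM ?groupV.
  (* A common point [v] of the cosets [j] and [i] splits [x^-1 * y] into [x^-1 * v] in [A j] and
     [v^-1 * y] in [A i]. *)
  have [||v [vG Pjv Piv]] := meetP j i; rewrite ?mem_head // ?inE ?jI ?orbT //.
  rewrite -[y](mulKVg v) mulgA.
  by apply: mem_mulg; apply/cosetP => //; apply: Px.
have bG := subsetP sBG _ bB.
have xbG : x * b \in G by rewrite groupM.
(* Since [x * b = y * a^-1], this element stays in the old cosets of [x] and also lies in the coset
   [y * A i]. *)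
exists (x * b) => // j; rewrite inE => /predU1P[->|jI].
  apply/(cosetP _ y) => //; rewrite -groupV !invMg invgK.
  by rewrite -mulgA def mulKg.
apply/(cosetP _ x) => //; first exact: Px.
by rewrite mulKg (subsetP (sB _ jI)).
Qed.

End Distributive.

(** * Colors of pairs and transport of triangles *)

Definition color (T : finType) (X : coherent_config T) (a b : T) :
    {set T * T} := pblock (basis X) (a, b).

Lemma color_basis (T : finType) (X : coherent_config T) a b :
  color X a b \in basis X.
Proof.
case: (basisP X) => /and3P[/eqP covX _ _] _ _ _.
by rewrite pblock_mem // covX inE.
Qed.

Lemma mem_color (T : finType) (X : coherent_config T) s a b :
  s \in basis X -> ((a, b) \in s) = (color X a b == s).
Proof.
case: (basisP X) => /and3P[/eqP covX trivX _] _ _ _ sX.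
apply/idP/eqP => [abs|<-]; first exact: def_pblock.
by rewrite mem_pblock covX inE.
Qed.

Lemma in_color (T : finType) (X : coherent_config T) a b x y :
  ((a, b) \in color X x y) = (color X a b == color X x y).
Proof. exact: mem_color (color_basis _ _ _). Qed.

Lemma colorP (T : finType) (X : coherent_config T) s :
  s \in basis X -> exists a b, color X a b = s.
Proof.
case: (basisP X) => /and3P[_ _ X0] _ _ _ sX.
have [s0|[[a b] abs]] := set_0Vmem s; first by rewrite -s0 sX in X0.
by exists a, b; apply/eqP; rewrite -(mem_color _ _ sX).
Qed.

Lemma color_sym (T : finType) (X : coherent_config T) a b a' b' :
  color X a b = color X a' b' -> color X b a = color X b' a'.
Proof.
case: (basisP X) => _ _ convX _.
have E x y : color X y x = conv (color X x y).
  have cX := convX _ (color_basis X x y).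
  by apply/eqP; rewrite -(mem_color y x cX) inE in_color.
by move=> eqc; rewrite [LHS]E eqc -E.
Qed.

Lemma color_diag (T : finType) (X : coherent_config T) a b d :
  color X a a = color X b d -> b = d.
Proof.
case: (basisP X) => _ [D /subsetP sDX covD] _ _ eqc.
have : (a, a) \in cover D by rewrite -covD mem_diag eqxx inE.
case/bigcupP=> s sD; rewrite (mem_color _ _ (sDX _ sD)) eqc => /eqP defs.
have : (b, d) \in cover D.
  by apply/bigcupP; exists s; rewrite // (mem_color _ _ (sDX _ sD)) defs.
by rewrite -covD mem_diag => /andP[/eqP ->].
Qed.

(** From here on, intersection numbers enter only through their positivity, that is, through the
    existence of triangles with prescribed colors. *)
Lemma intersection_number_gt0 (T : finType) (X : coherent_config T) r s a b :
  r \in basis X -> s \in basis X ->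
  0 < intersection_number r s (color X a b) <->
  exists z, color X a z = r /\ color X z b = s.
Proof.
move=> rX sX.
have abt : (a, b) \in color X a b by rewrite in_color.
have -> : intersection_number r s (color X a b) = nint r s a b.
  rewrite /intersection_number; case: pickP => [[x y] xyt|/(_ (a, b))].
    case: (basisP X) => _ _ _ cohX.
    by apply: cohX (color_basis _ _ _) _ _ _ _ xyt abt.
  by rewrite abt.
split=> [/card_gt0P[z]|[z [rz sz]]].
  rewrite !inE /= (mem_color _ _ rX) (mem_color _ _ sX).
  by case/andP=> /eqP rz /eqP sz; exists z.
by apply/card_gt0P; exists z; rewrite !inE -rz -sz !in_color !eqxx.
Qed.

(** The basic tool: the number of triangles with given side colors over a pair depends only on the
    color of that pair, so a triangle can be copied. *)
Lemma color_triangle (T : finType) (X : coherent_config T) a b a' b' z :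
  color X a b = color X a' b' ->
  exists z', color X a' z' = color X a z /\ color X z' b' = color X z b.
Proof.
move=> eqc; apply/intersection_number_gt0; rewrite ?color_basis // -eqc.
by apply/intersection_number_gt0; rewrite ?color_basis //; exists z.
Qed.

Lemma color_target (T : finType) (X : coherent_config T) a b a' b' :
  color X a b = color X a' b' -> color X b b = color X b' b'.
Proof.
move=> /(color_triangle b)[z [_ zb]].
by rewrite -zb (color_diag (esym zb)).
Qed.

Lemma color_fiber (T : finType) (X : coherent_config T) x :
  [set y | color X y y == color X x x] \in fibers X.
Proof.
rewrite inE (_ : diag _ = color X x x) ?color_basis //.
apply/setP=> -[y z]; rewrite mem_diag inE in_color //.
apply/andP/eqP => [[/eqP<- /eqP]//|eqc].
by split; rewrite (color_diag (esym eqc)) ?eqxx // -eqc (color_diag (esym eqc)).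
Qed.

(** * Quasiregular configurations and the group acting on a fiber *)

Lemma quasiregular_inj (T : finType) (X : coherent_config T) x y z :
  quasiregular X -> color X x x = color X y y -> color X x y = color X x z ->
  y = z.
Proof.
move=> qX xy eqc; set D := [set y | color X y y == color X x x].
have fD : D \in fibers X := color_fiber _ _.
have [_ thinD] := qX D fD.
have xD : x \in D by rewrite inE.
have yD : y \in D by rewrite inE xy.
have zD : z \in D by rewrite inE xy (color_target eqc).
have xyc : (x, y) \in color X x y by rewrite in_color.
have sX : restrict D (color X x y) \in basis (component fD).
  apply/imsetP; exists (color X x y) => //; rewrite inE color_basis /=.
  exact: fiber_subset fD (color_basis _ _ _) xyc xD yD.
have [/card_le1_eqP le1 _] := thinD _ sX (exist _ x xD).
pose u : {x | x \in D} := exist _ y yD; pose v : {x | x \in D} := exist _ z zD.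
suff /(congr1 val) : u = v by [].
by apply: le1; rewrite !inE /= in_color ?eqc.
Qed.

(* [w x y] stands for the basis relation through [(x, y)], both points in the
   fiber of [x0]; its values outside that fiber are junk. *)
Definition group_coloring (T : finType) (X : coherent_config T) (x0 : T)
    (gT : finGroupType) (G : {group gT}) (w : T -> T -> gT) : Prop :=
  let fib x := color X x x = color X x0 x0 in
  [/\ forall x y, fib x -> fib y -> w x y \in G,
      forall x y z, fib x -> fib y -> fib z -> (w x y * w y z)%g = w x z,
      forall x y u v, fib x -> fib y -> fib u -> fib v ->
        color X x y = color X u v <-> w x y = w u v
    & forall x g, fib x -> g \in G -> exists2 y, fib y & w x y = g].

(** [w x y] is the unique [g] in [G] whose relation [f g] contains the pair; composition of
    relations turns into the product rule. *)
Lemma isog_basis_coloring (T : finType) (X : coherent_config T) (x0 : T)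
    (fD : [set y | color X y y == color X x0 x0] \in fibers X)
    (gT : finGroupType) (G : {group gT}) :
  isog_basis (component fD) G -> exists w, group_coloring X x0 G w.
Proof.
set D := [set _ | _] in fD *.
case=> f [inj_f im_f fM]; pose fib x := color X x x = color X x0 x0.
have fibD x : fib x -> x \in D by rewrite inE => ->.
(* Quantifying over the membership proofs makes [P] a predicate on plain points of [T]. *)
pose P x y g := forall (hx : x \in D) (hy : y \in D),
  (exist _ x hx, exist _ y hy) \in f g.
have fP g : g \in G -> exists2 s, s \in basis X &
    s \subset setX D D /\ f g = restrict D s.
  move=> gG; have : f g \in basis (component fD) by rewrite -im_f imset_f.
  by case/imsetP=> s /setIdP[sX sD] ->; exists s.
have PE x y g s : fib x -> fib y -> f g = restrict D s ->
    P x y g <-> (x, y) \in s.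
  move=> /fibD xD /fibD yD fg; split=> [/(_ xD yD)|xys hx hy].
    by rewrite fg restrict_in.
  by rewrite fg restrict_in.
have Pex x y : fib x -> fib y -> exists2 g, g \in G & P x y g.
  move=> xF yF; have xyD : color X x y \subset setX D D.
    have xyc : (x, y) \in color X x y by rewrite in_color.
    exact: fiber_subset fD (color_basis X x y) xyc (fibD _ xF) (fibD _ yF).
  have : restrict D (color X x y) \in f @: G.
    rewrite im_f; apply/imsetP.
    by exists (color X x y); rewrite // inE color_basis.
  case/imsetP=> g gG fg; exists g => //.
  by apply/(PE _ _ _ (color X x y)) => //; rewrite in_color.
have Puniq x y g h : fib x -> fib y -> g \in G -> h \in G ->
    P x y g -> P x y h -> g = h.
  move=> xF yF gG hG Pg Ph; apply: inj_f => //.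
  have [s sX [_ fg]] := fP _ gG; have [t tX [_ fh]] := fP _ hG.
  have /(PE _ _ _ _ xF yF fg) := Pg; have /(PE _ _ _ _ xF yF fh) := Ph.
  by rewrite (mem_color _ _ sX) (mem_color _ _ tX) fg fh => /eqP<- /eqP<-.
pose Q (p : T * T) g := fib p.1 -> fib p.2 -> g \in G /\ P p.1 p.2 g.
have [w wP] : exists w, forall p, Q p (w p).
  apply: fin_all_exists => -[x y]; rewrite /Q /=.
  have [xF|/eqP xF] := eqVneq (color X x x) (color X x0 x0); last by exists 1%g.
  have [yF|/eqP yF] := eqVneq (color X y y) (color X x0 x0); last by exists 1%g.
  by have [g] := Pex _ _ xF yF; exists g.
exists (fun x y => w (x, y)); split.
- by move=> x y xF yF; case: (wP (x, y)).
- move=> x y z xF yF zF.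
  have [Gxy Pxy] := wP (x, y) xF yF; have [Gyz Pyz] := wP (y, z) yF zF.
  have [Gxz Pxz] := wP (x, z) xF zF.
  apply: (Puniq _ _ _ _ xF zF _ Gxz _ Pxz); first exact: groupM.
  move=> hx hz; rewrite fM // inE; apply/existsP.
  exists (exist _ y (fibD _ yF)).
  by apply/andP; split; [apply: Pxy | apply: Pyz].
- move=> x y u v xF yF uF vF.
  have [Gxy Pxy] := wP (x, y) xF yF; have [Guv Puv] := wP (u, v) uF vF.
  have [s sX [_ fs]] := fP _ Gxy.
  have xys : color X x y = s.
    by apply/eqP; rewrite -(mem_color _ _ sX); apply/(PE _ _ _ _ xF yF fs).
  split=> [eqc|eqw].
    apply: (Puniq _ _ _ _ uF vF _ Guv _ Puv) => //.
    by apply/(PE _ _ _ _ uF vF fs); rewrite (mem_color _ _ sX) -eqc xys.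
  rewrite xys; apply/esym/eqP; rewrite -(mem_color _ _ sX).
  by apply/(PE _ _ _ _ uF vF fs); rewrite eqw.
- move=> x g xF gG; have [s sX [/subsetP sD fg]] := fP _ gG.
  have [u [v uv]] := colorP sX.
  have uvs : (u, v) \in s by rewrite (mem_color _ _ sX) uv.
  have /setXP[uD _] := sD _ uvs.
  have /esym uF : color X u u = color X x x.
    by rewrite xF; apply/eqP; rewrite inE in uD.
  (* The loops at [u] and [x] have the same color, so the degenerate triangle [u, v, u] is copied to
     [x, y, x]. *)
  have [y [xy _]] := color_triangle v (esym uF).
  have xys : (x, y) \in s by rewrite (mem_color _ _ sX) xy uv.
  have /setXP[_ yD] := sD _ xys.
  have yF : fib y by apply/eqP; rewrite inE in yD.
  exists y => //; have [Gw Pw] := wP (x, y) xF yF.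
  by apply: (Puniq _ _ _ _ xF yF Gw gG Pw); apply/(PE _ _ _ _ xF yF fg).
Qed.

(** [A] collects the differences [w y y'] of points that [z] sees in the same color. Copying
    triangles shows that this depends on the difference alone, and that [A] is invariant under
    conjugation. *)
Lemma color_stabilizer (T : finType) (X : coherent_config T) (x0 z : T)
    (gT : finGroupType) (G : {group gT}) (w : T -> T -> gT) :
  quasiregular X -> group_coloring X x0 G w ->
  exists2 A : {group gT}, (A <| G)%g & forall y y',
    color X y y = color X x0 x0 -> color X y' y' = color X x0 x0 ->
    (w y y' \in A) = (color X z y == color X z y').
Proof.
move=> qX [wG wM wE wS]; pose fib x := color X x x = color X x0 x0.
have transl y y' u u' : color X y y' = color X u u' ->
    color X z y = color X z y' -> color X z u = color X z u'.
  (* The copy [v] of [z] over [(u, u')] sees [u] and [u'] in the same color. Copying [z] from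
     [(v, u)] to [(v, u')] then gives a point [t], which is [z] itself because the fiber of [z] is
     regular. *)
  move=> eqc zy; have [v [uv vu']] := color_triangle z eqc.
  have [t [vt tu']] : exists t,
      color X v t = color X v z /\ color X t u' = color X z u.
    by apply: color_triangle; rewrite (color_sym uv) vu'.
  have vz : color X v v = color X z z by apply/esym/(color_target (esym uv)).
  by rewrite -tu' (quasiregular_inj qX vz (esym vt)).
pose A := [set g in G | [forall y, forall y', [==> color X y y == color X x0 x0,
  color X y' y' == color X x0 x0, w y y' == g => color X z y == color X z y']]].
have inA y y' : fib y -> fib y' ->
    (w y y' \in A) = (color X z y == color X z y').
  move=> yF y'F; rewrite inE wG //=; apply/idP/eqP => [|eqz].
    by move=> /forallP/(_ y)/forallP/(_ y'); rewrite yF y'F !eqxx => /eqP.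
  apply/forallP=> u; apply/forallP=> u'.
  apply/implyP=> /eqP uF; apply/implyP=> /eqP u'F; apply/implyP=> /eqP/esym eqw.
  by apply/eqP; apply: (transl y y') => //; exact/wE.
have x0F : fib x0 by [].
have AE g : g \in A -> exists2 y, fib y & w x0 y = g.
  by rewrite inE => /andP[gG _]; apply: wS.
have w1 : w x0 x0 = 1%g by apply: (mulgI (w x0 x0)); rewrite wM // mulg1.
have gA : group_set A.
  apply/group_setP; split=> [|g h]; first by rewrite -w1 inA.
  move=> gA hA; have [y yF def_g] := AE _ gA.
  have [y' y'F def_h] : exists2 y', fib y' & w y y' = h.
    by apply: wS => //; move: hA; rewrite inE => /andP[].
  by move: gA hA; rewrite -def_g -def_h wM // !inA // => /eqP->.
exists (Group gA) => //; apply/andP; split.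
  by apply/subsetP=> g; rewrite inE => /andP[].
apply/subsetP=> h hG; rewrite inE; apply/subsetP=> _ /imsetP[g Ag ->].
have [y yF def_h] := wS _ _ x0F hG; have [u uF def_g] := AE _ Ag.
have [v vF uv] := wS _ _ uF hG.
(* The conjugate is the product of [w y x0], [w x0 u] and [w u v], with values [h^-1], [g] and
   [h]. *)
have -> : (g ^ h)%g = w y v.
  by apply: (mulgI h); rewrite mulKVg -[in RHS]def_h wM // -uv -def_g wM.
rewrite inA //; rewrite -def_g inA // in Ag.
(* As [z] sees [x0] and [u] alike, [y] has a copy [t] over [(z, u)]; its difference from [u] is [h],
   so it must be [v]. *)
have [t [zt tu]] := color_triangle y (eqP Ag).
have hE : color X x0 y = color X u v by apply/wE; rewrite // uv.
have ut : color X u t = color X u v by rewrite (color_sym tu).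
suff <- : t = v by rewrite zt.
apply: (quasiregular_inj qX _ ut).
by rewrite (color_target ut) uF vF.
Qed.

(* The points [y] of a fiber with [color X z y] prescribed form a coset of a
   normal subgroup of the group acting regularly on that fiber. *)
Lemma color_helly (T : finType) (X : coherent_config T) (x0 : T)
    (gT : finGroupType) (G : {group gT}) (w : T -> T -> gT)
    (J : eqType) (I : seq J) (z : J -> T) (s : J -> {set T * T}) :
  quasiregular X -> group_coloring X x0 G w -> distributive_normal_lattice G ->
  (forall i j, i \in I -> j \in I -> exists y,
    [/\ color X y y = color X x0 x0, color X (z i) y = s i
      & color X (z j) y = s j]) ->
  exists2 y, color X y y = color X x0 x0 &
    forall i, i \in I -> color X (z i) y = s i.
Proof.
move=> qX wP dG meetP; have [wG wM wE wS] := wP.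
have w_inj y y' : color X y y = color X x0 x0 ->
    color X y' y' = color X x0 x0 -> w x0 y = w x0 y' -> y = y'.
  move=> yF y'F /wE eqc.
  by apply: (quasiregular_inj qX (x := x0)) => //; apply: eqc.
have [A nA memA] : exists2 A : T -> {group gT}, forall t, (A t <| G)%g &
    forall t y y', color X y y = color X x0 x0 ->
    color X y' y' = color X x0 x0 ->
    (w y y' \in A t) = (color X t y == color X t y').
  by apply: (fin_all_exists2 (fun t => color_stabilizer t qX wP)).
(* The base point [x0] identifies the fiber with [G], turning each color condition into a coset of
   [A (z i)]. *)
pose P i g := exists y,
  [/\ color X y y = color X x0 x0, w x0 y = g & color X (z i) y = s i].
have [|i x y xG yG [u [uF ux us]]|i j iI jI|x xG Px] :=
    distributive_chinese (I := I) (A := A \o z) (P := P) dG.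
- by move=> i; apply: nA.
- have [v vF vy] := wS x0 y (erefl _) yG.
  have -> : (x^-1 * y)%g = w u v by rewrite -ux -vy -(wM x0 u v) // mulKg.
  rewrite /= memA // us; split=> [[v' [v'F v'y v's]]|/eqP vs]; last by exists v.
  by rewrite (w_inj v v') ?vy // v's.
- have [y [yF ys1 ys2]] := meetP i j iI jI.
  by exists (w x0 y); split; [exact: wG | exists y | exists y].
have [y yF xy] := wS x0 x (erefl _) xG.
exists y => // i /Px[y' [y'F y'x <-]]; congr color.
by apply: w_inj; rewrite // xy.
Qed.

(** * Action of an algebraic isomorphism on colors *)

(** Surjectivity of [phi] names the side colors in [X]; equal intersection numbers then make the
    triangle exist there. *)
Lemma alg_color_pull (T T' : finType) (X : coherent_config T)
    (X' : coherent_config T') phi a b a' b' z' :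
  algebraic_isomorphism X X' phi -> phi (color X a b) = color X' a' b' ->
  exists z, phi (color X a z) = color X' a' z' /\
            phi (color X z b) = color X' z' b'.
Proof.
case=> _ im ints eqc.
have : color X' z' b' \in phi @: basis X by rewrite im color_basis.
have : color X' a' z' \in phi @: basis X by rewrite im color_basis.
case/imsetP=> r rX er /imsetP[s sX es].
have /intersection_number_gt0[//|//|z [az zb]] :
    0 < intersection_number r s (color X a b).
  rewrite ints ?color_basis // -er -es eqc.
  by apply/intersection_number_gt0; rewrite ?color_basis //; exists z'.
by exists z; rewrite az zb er es.
Qed.

Lemma alg_color_push (T T' : finType) (X : coherent_config T)
    (X' : coherent_config T') phi a b a' b' z :
  algebraic_isomorphism X X' phi -> phi (color X a b) = color X' a' b' ->
  exists z', phi (color X a z) = color X' a' z' /\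
             phi (color X z b) = color X' z' b'.
Proof.
case=> _ im ints eqc.
have inX' x y : phi (color X x y) \in basis X'.
  by rewrite -im imset_f ?color_basis.
suff [z' [az zb]] : exists z', color X' a' z' = phi (color X a z) /\
    color X' z' b' = phi (color X z b) by exists z'.
apply/intersection_number_gt0; rewrite ?inX' // -eqc -ints ?color_basis //.
by apply/intersection_number_gt0; rewrite ?color_basis //; exists z.
Qed.

(** An algebraic isomorphism is not assumed to respect the diagonal or converses; this and the next
    lemmas recover both from degenerate triangles and injectivity. *)
Lemma alg_color_diagV (T T' : finType) (X : coherent_config T)
    (X' : coherent_config T') phi a d b' :
  algebraic_isomorphism X X' phi -> phi (color X a d) = color X' b' b' -> a = d.
Proof.
move=> iso; have [inj_phi _ _] := iso => eqc.
have [z' [bz zb]] := alg_color_push d iso eqc.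
have ez : b' = z' by apply: (@color_diag _ X' b'); rewrite -bz.
apply: (@color_diag _ X d); apply: inj_phi; rewrite ?color_basis //.
by rewrite zb -ez.
Qed.

Lemma alg_color_diag (T T' : finType) (X : coherent_config T)
    (X' : coherent_config T') phi a b' d' :
  algebraic_isomorphism X X' phi -> phi (color X a a) = color X' b' d' ->
  b' = d'.
Proof.
move=> iso eqc; have [z [az _]] := alg_color_pull b' iso eqc.
have ez := alg_color_diagV iso az.
by apply: (@color_diag _ X' b'); rewrite -az -ez.
Qed.

Lemma alg_color_source (T T' : finType) (X : coherent_config T)
    (X' : coherent_config T') phi a b a' b' :
  algebraic_isomorphism X X' phi -> phi (color X a b) = color X' a' b' ->
  phi (color X a a) = color X' a' a'.
Proof.
move=> iso eqc; have [z [az _]] := alg_color_pull a' iso eqc.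
by rewrite -az (alg_color_diagV iso az).
Qed.

(** Pushing [b] along the loop at [a] yields both directions of the edge at once. *)
Lemma alg_color_sym (T T' : finType) (X : coherent_config T)
    (X' : coherent_config T') phi a b a' b' :
  algebraic_isomorphism X X' phi -> phi (color X a b) = color X' a' b' ->
  phi (color X b a) = color X' b' a'.
Proof.
move=> iso eqc; have aa := alg_color_source iso eqc.
have [z' [az za]] := alg_color_push b iso aa.
by rewrite za; apply: color_sym; rewrite -az.
Qed.

(** * Extension of color-respecting maps *)

Definition distributive_type (T : finType) (X : coherent_config T) : Prop :=
  forall (D : {set T}) (fD : D \in fibers X),
    exists (gT : finGroupType) (G : {group gT}),
      distributive_normal_lattice G /\ isog_basis (component fD) G.

Lemma alg_color_point (T T' : finType) (X : coherent_config T)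
    (X' : coherent_config T') phi e :
  algebraic_isomorphism X X' phi ->
  exists x, phi (color X x x) = color X' e e.
Proof.
move=> iso; have [_ im _] := iso.
have : color X' e e \in phi @: basis X by rewrite im color_basis.
case/imsetP=> s /colorP[x [y <-]] es; exists x.
by rewrite es -(alg_color_diagV iso (esym es)).
Qed.

Lemma alg_color_extend1 (T T' : finType) (X : coherent_config T)
    (X' : coherent_config T') phi (I : seq T') (g : T' -> T) e :
  quasiregular X -> distributive_type X -> algebraic_isomorphism X X' phi ->
  {in I &, forall a b, phi (color X (g a) (g b)) = color X' a b} ->
  exists2 y, phi (color X y y) = color X' e e &
    {in I, forall a, phi (color X (g a) y) = color X' a e}.
Proof.
move=> qX dX iso gI; have [inj_phi im _] := iso.
have phi_pre r : r \in basis X' -> exists2 s, s \in basis X & phi s = r.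
  by rewrite -im => /imsetP[s sX ->]; exists s.
have [x0 ex0] := alg_color_point e iso.
have [gT [G [dG isoG]]] := dX _ (color_fiber X x0).
have [w wP] := isog_basis_coloring isoG.
have [s sX es] : exists2 s : T' -> {set T * T}, forall a, s a \in basis X &
    forall a, phi (s a) = color X' a e.
  exact: (fin_all_exists2 (fun a => phi_pre _ (color_basis X' a e))).
have [i j iI jI|y yF ys] := color_helly (I := I) (z := g) (s := s) qX wP dG.
  (* Pairwise compatibility: pulling [e] back over [(g i, g j)] gives a point that meets both
     conditions and lies in the fiber of [x0]. *)
  have [y [iy yj]] := alg_color_pull e iso (gI i j iI jI).
  have jy := alg_color_sym iso yj.
  have yy := alg_color_source iso yj.
  by exists y; split; apply: inj_phi; rewrite ?color_basis ?sX ?es ?ex0.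
by exists y; rewrite ?yF // => a /ys->.
Qed.

Lemma alg_color_extend (T T' : finType) (X : coherent_config T)
    (X' : coherent_config T') phi (I : seq T') (g : T' -> T) :
  quasiregular X -> distributive_type X -> algebraic_isomorphism X X' phi ->
  {in I &, forall a b, phi (color X (g a) (g b)) = color X' a b} ->
  exists2 h : T' -> T, {in I, h =1 g} &
    forall a b, phi (color X (h a) (h b)) = color X' a b.
Proof.
move=> qX dX iso gI.
suff [h [hg hE]] : exists h : T' -> T, {in I, h =1 g} /\
    {in enum T' ++ I &, forall a b, phi (color X (h a) (h b)) = color X' a b}.
  by exists h => // a b; apply: hE; rewrite mem_cat mem_enum.
elim: (enum T') => [|e E [h [hg hE]]]; first by exists g.
(* A point already treated keeps its value, so that [h] still agrees with [g] on [I]. *)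
have [eE|eE] := boolP (e \in E ++ I).
  exists h; split=> // a b; rewrite !inE => /predU1P aE /predU1P bE.
  by apply: hE; [case: aE => [->|] | case: bE => [->|]].
have [y yy ya] := alg_color_extend1 e qX dX iso hE.
pose k a := if a == e then y else h a; exists k.
have kE a : a \in E ++ I -> k a = h a.
  by rewrite /k; case: eqP => // ->; rewrite (negPf eE).
split=> [a aI|a b]; first by rewrite kE ?hg // mem_cat aI orbT.
have ke : k e = y by rewrite /k eqxx.
rewrite cat_cons !inE => /predU1P[->|aE] /predU1P[->|bE]; rewrite ?ke //.
- by rewrite kE //; apply: (alg_color_sym iso); apply: ya.
- by rewrite kE //; apply: ya.
by rewrite !kE //; apply: hE.
Qed.

(** Injectivity comes from the diagonal. For surjectivity, each fiber of [X] contains some [h b'],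
    and in a regular fiber a point is determined by its color from [h b'], which is also the color
    of some [h c]. *)
Lemma alg_color_bij (T T' : finType) (X : coherent_config T)
    (X' : coherent_config T') phi (h : T' -> T) :
  quasiregular X -> algebraic_isomorphism X X' phi ->
  (forall a b, phi (color X (h a) (h b)) = color X' a b) -> bijective h.
Proof.
move=> qX iso hE; have [inj_phi im _] := iso.
have inj_h : injective h.
  move=> a b hab; apply: (alg_color_diag (a := h a) iso).
  by rewrite -hE -hab.
apply: inj_card_bij => //; rewrite -(card_codom inj_h).
apply/subset_leq_card/subsetP=> b _; apply/codomP.
have : phi (color X b b) \in basis X' by rewrite -im imset_f ?color_basis.
case/colorP=> b' [d' bd]; have ebd := alg_color_diag iso (esym bd).
rewrite -ebd -hE in bd; have {}bd : color X (h b') (h b') = color X b b.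
  by apply: inj_phi; rewrite ?color_basis.
have [c [bc _]] := alg_color_push b iso (hE b' b').
exists c; apply: (quasiregular_inj qX bd).
by apply: inj_phi; rewrite ?color_basis // bc hE.
Qed.

(** * Schurity and separability *)

Lemma alg_iso_id (T : finType) (X : coherent_config T) :
  algebraic_isomorphism X X id.
Proof. by split=> //; rewrite imset_id. Qed.

Lemma distributive_schurian (T : finType) (X : coherent_config T) :
  quasiregular X -> distributive_type X -> schurian X.
Proof.
move=> qX dX; have iso := alg_iso_id X.
pose A := [set p : {perm T} |
  [forall a, forall b, color X (p a) (p b) == color X a b]].
have AP (p : {perm T}) :
    reflect (forall a b, color X (p a) (p b) = color X a b) (p \in A).
  rewrite inE; apply: (iffP forallP) => [pA a b|pA a].
    by have /forallP/(_ b)/eqP := pA a.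
  by apply/forallP=> b; apply/eqP.
have gA : group_set A.
  apply/group_setP; split=> [|p q /AP pA /AP qA]; apply/AP => a b.
    by rewrite !perm1.
  by rewrite !permM qA pA.
have orbitE a b : pair_orbit (Group gA) (a, b) = color X a b.
  apply/setP=> -[c d]; rewrite in_color.
  apply/imsetP/eqP => [[p /AP pA [-> ->]]|cd].
    exact: pA.
  (* If [a = b], then [color_diag] forces [c = d], so [g] is right on both points. *)
  pose g x := if x == a then c else d.
  have ga : g a = c by rewrite /g eqxx.
  have gb : g b = d.
    rewrite /g; case: eqP => // ba; by move: cd; rewrite ba => /esym/color_diag.
  have [|h hg hE] := alg_color_extend (I := [:: a; b]) (g := g) qX dX iso.
    move=> x y; rewrite !inE => /orP[]/eqP-> /orP[]/eqP->; rewrite ?ga ?gb //=.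
    - exact: (alg_color_source iso cd).
    - exact: color_sym.
    exact: color_target cd.
  have inj_h := bij_inj (alg_color_bij qX iso hE).
  exists (perm inj_h); first by apply/AP=> x y; rewrite !permE; apply: hE.
  by rewrite /= !permE !hg ?inE ?eqxx ?orbT // ga gb.
exists (Group gA); apply/setP=> s; apply/idP/imsetP => [sX|[[a b] _ ->]].
  by have [a [b <-]] := colorP sX; exists (a, b); rewrite ?inE ?orbitE.
by rewrite orbitE color_basis.
Qed.

Lemma distributive_separable (T : finType) (X : coherent_config T) :
  quasiregular X -> distributive_type X -> separable X.
Proof.
move=> qX dX T' X' phi iso; have [inj_phi im _] := iso.
(* Extending the empty map still needs some total function [g] from [T'] to [T]; its values are
   irrelevant. *)
have [g _] := fin_all_exists (fun e => alg_color_point e iso).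
have [//|h _ hE] := alg_color_extend (I := [::]) (g := g) qX dX iso.
(* The extension [h] runs from [X'] back to [X], so the required bijection is its inverse [f]. *)
have [f hK fK] := alg_color_bij qX iso hE.
exists f => [|s sX]; first by exists h.
have sX' : phi s \in basis X' by rewrite -im imset_f.
apply/setP=> -[a b].
rewrite (mem_color _ _ sX') -hE (inj_in_eq inj_phi) ?color_basis //.
rewrite -(mem_color _ _ sX); apply/imsetP/idP => [[[x y] xys [-> ->]]|abs].
  by rewrite !fK.
by exists (h a, h b); rewrite //= !hK.
Qed.

Theorem theorem1p2
  (GG : forall gT : finGroupType, {group gT} -> Prop)
  (hGG : forall (gT : finGroupType) (G : {group gT}),
     GG gT G -> distributive_normal_lattice G)
  (T : finType) (X : coherent_config T)
  (qrX : quasiregular X) (typX : of_type X GG) :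
  schurian X /\ separable X.
Proof.
have dX : distributive_type X.
  move=> D fD; have [gT [G [gG isoG]]] := typX D fD.
  by exists gT, G; split=> //; apply: hGG.
by split; [apply: distributive_schurian | apply: distributive_separable].
Qed.
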